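(* Let $S$ be a semiring with a Strassen preorder, $i:S\to\overline S$ its asymptotic completion, and $s\in S$. Then, identifying $\overline{\mathbb N}$ with $\{0\}\cup[1,\infty)$ as a subset of $\overline S$, \[\underset{\sim}{R}(s)=\min\{m\in\{0\}\cup[1,\infty)=\overline{\mathbb N}\subseteq\overline S : i(s)\le m\},\] and if $2\le s^p$ for some $p\in\mathbb N$, then \[\underset{\sim}{Q}(s)=\max\{m\in\{0\}\cup[1,\infty)=\overline{\mathbb N}\subseteq\overline S : m\le i(s)\}.\] Here $\underset{\sim}{R}$ and $\underset{\sim}{Q}$ denote the asymptotic rank and the asymptotic subrank.
   Context: Semirings are commutative, with $0$ and $1$. A preordered semiring is a semiring $S$ with a reflexive transitive relation $\le$ such that $x\le y$ implies $z+x\le z+y$ and $zx\le zy$ for all $x,y,z\in S$; it is a partially ordered semiring if $\le$ is also antisymmetric. Monotone homomorphisms are order-preserving semiring homomorphisms. A nonzero element $u\in S$ is power universal if $1\le u$ and for all nonzero $x,y\in S$ with $x\le y$ there is $k\in\mathbb N$ with $y\le u^kx$; $S$ is of polynomial growth if it has a power universal element. All preordered semirings are assumed to be of polynomial growth, with a fixed power universal element $u$ (the notions below do not depend on the choice). $\mathbb N$ includes $0$. A sublinear sequence is a sequence $(k_n)_{n\in\mathbb N}$ in $\mathbb N$ with $\lim_{n\to\infty}k_n/n=0$. A preorder on a semiring $S$ making it a preordered semiring is a Strassen preorder if the unique semiring homomorphism $\mathbb N\to S$ is an order embedding and $u=2$ is power universal; $\mathbb N$ is then regarded as a subset of $S$.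 For $s\in S$ the rank is $R(s)=\min\{m\in\mathbb N: s\le m\}$, the subrank is $Q(s)=\max\{m\in\mathbb N: m\le s\}$, the asymptotic rank is $\underset{\sim}{R}(s)=\lim_{n\to\infty}\sqrt[n]{R(s^n)}$ and the asymptotic subrank is $\underset{\sim}{Q}(s)=\lim_{n\to\infty}\sqrt[n]{Q(s^n)}$ (these limits exist). For $a,b\in S^{\mathbb N}$: $(a\oplus b)_n=\sum_{m=0}^n\binom nm a_{n-m}b_m$; $(a\odot b)_n=a_nb_n$; $a\lesssim b$ means that there is a sublinear sequence $(k_n)$ with $a_n\le u^{k_n}b_n$ for all $n\in\mathbb N$; $a\approx b$ means $a\lesssim b$ and $b\lesssim a$. For $s\in S$, $G(s)=(1,s,s^2,\dots)$. A sequence $a\in S^{\mathbb N}$ is approximately geometric if either $a\approx G(0)$, or $a_n\ne0$ for all $n$ and there is a sublinear sequence $(k_n)$ such that for all $t\in\mathbb N_{>0}$ and $n_1,\dots,n_t\in\mathbb N$ both $a_{n_1}\cdots a_{n_t}\le u^{k_{n_1}+\dots+k_{n_t}}a_{n_1+\dots+n_t}$ and $a_{n_1+\dots+n_t}\le u^{k_{n_1}+\dots+k_{n_t}}a_{n_1}\cdots a_{n_t}$ hold. $S$ is closed if $G(x)\lesssim G(y)$ implies $x\le y$ for all $x,y\in S$, and asymptotically complete if for every approximately geometric sequence $a\in(S\setminus\{0\})^{\mathbb N}$ there is $s\in S$ with $a\approx G(s)$. The asymptotic completion of $S$ is a closed, asymptotically complete partially ordered semiring $\overline S$ with a monotone homomorphism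 $i:S\to\overline S$ such that $i(u)$ is power universal and every monotone homomorphism $f$ from $S$ to an asymptotically complete closed partially ordered semiring $T$ factors uniquely as $f=g\circ i$ with $g:\overline S\to T$ a monotone homomorphism. It is unique up to isomorphism, and is realized by the set of $\approx$-classes $[a]$ of approximately geometric sequences in $S$, with addition, multiplication and order induced by $\oplus,\odot,\lesssim$, and $i(s)=[G(s)]$. Identification of $\overline{\mathbb N}$: an approximately geometric sequence $x=(x_n)$ of natural numbers corresponds to the real number $\lim_{n\to\infty}\sqrt[n]{x_n}\in\{0\}\cup[1,\infty)$; this identifies the asymptotic completion $\overline{\mathbb N}$ with $\{0\}\cup[1,\infty)$ (usual operations and order), and the inclusion $\mathbb N\subseteq S$ induces an embedding $\overline{\mathbb N}\subseteq\overline S$. Concretely, $0$ corresponds to $0\in\overline S$ and a real $r\ge1$ corresponds to the class of the sequence $(\lfloor r^n\rfloor)_{n\in\mathbb N}$ in $\mathbb N\subseteq S$. *)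

(* Defs.v *)
From HB Require Import structures.
From mathcomp Require Import all_boot all_order all_algebra.
From mathcomp Require Import all_classical all_reals all_analysis.

Set Implicit Arguments.
Unset Strict Implicit.
Unset Printing Implicit Defensive.

Import Order.TTheory GRing.Theory Num.Theory.
Import numFieldNormedType.Exports.

Local Open Scope classical_set_scope.
Local Open Scope ring_scope.

Reserved Notation "x <=s y" (at level 70, no associativity).

(* The preorder is not an Order.Preorder: Hierarchy-Builder does not accept a
   join of GRing.ComPzSemiRing and Order.Preorder declared after ssrnum. *)
HB.mixin Record isPreorderedSemiRing S of GRing.ComPzSemiRing S := {
  psr_le : S -> S -> Prop;
  psr_lexx : forall x : S, psr_le x x;
  psr_le_trans : forall y x z : S, psr_le x y -> psr_le y z -> psr_le x z;
  psr_leD2l : forall z x y : S, psr_le x y -> psr_le (z + x) (z + y);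
  psr_leM2l : forall z x y : S, psr_le x y -> psr_le (z * x) (z * y)
}.

#[short(type="preorderedSemiRingType")]
HB.structure Definition PreorderedSemiRing :=
  { S of GRing.ComPzSemiRing S & isPreorderedSemiRing S }.

Notation "x <=s y" := (psr_le x y) : ring_scope.

HB.mixin Record PreorderedSemiRing_isPOrdered S of PreorderedSemiRing S := {
  psr_le_anti : forall x y : S, x <=s y -> y <=s x -> x = y
}.

#[short(type="porderedSemiRingType")]
HB.structure Definition POrderedSemiRing :=
  { S of PreorderedSemiRing S & PreorderedSemiRing_isPOrdered S }.

Definition minimum_of d (T : porderType d) (A : set T) (x : T) : Prop :=
  A x /\ lbound A x.

Definition maximum_of d (T : porderType d) (A : set T) (x : T) : Prop :=
  A x /\ ubound A x.

(* The limit is taken in the rationals; the value at n = 0 is irrelevant. *)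
Definition sublinear (k : nat -> nat) : Prop :=
  (fun n => (k n)%:R / n%:R : rat^o) @ \oo --> (0 : rat^o).

Definition power_universal (S : preorderedSemiRingType) (u : S) : Prop :=
  [/\ u != 0, 1 <=s u &
      forall x y : S, x != 0 -> y != 0 -> x <=s y ->
        exists k : nat, y <=s u ^+ k * x].

Definition geom (S : preorderedSemiRingType) (s : S) : nat -> S :=
  fun n => s ^+ n.

(* In the definitions below, u stands for the fixed power universal element. *)

Definition seq_lesssim (S : preorderedSemiRingType) (u : S) (a b : nat -> S) :
    Prop :=
  exists2 k, sublinear k & forall n, a n <=s u ^+ k n * b n.

Definition seq_approx (S : preorderedSemiRingType) (u : S) (a b : nat -> S) :
    Prop :=
  seq_lesssim u a b /\ seq_lesssim u b a.

Definition approx_geometric (S : preorderedSemiRingType) (u : S)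
    (a : nat -> S) : Prop :=
  seq_approx u a (geom 0) \/
  (forall n, a n != 0) /\
  exists2 k, sublinear k &
    forall (t : nat) (n : 'I_t -> nat), (0 < t)%N ->
      \prod_(j < t) a (n j)
        <=s u ^+ (\sum_(j < t) k (n j))%N * a (\sum_(j < t) n j)%N /\
      a (\sum_(j < t) n j)%N
        <=s u ^+ (\sum_(j < t) k (n j))%N * \prod_(j < t) a (n j).

Definition asymp_closed (S : preorderedSemiRingType) (u : S) : Prop :=
  forall x y : S, seq_lesssim u (geom x) (geom y) -> x <=s y.

Definition asymp_complete (S : preorderedSemiRingType) (u : S) : Prop :=
  forall a : nat -> S, (forall n, a n != 0) -> approx_geometric u a ->
    exists s : S, seq_approx u a (geom s).

(* The fixed power universal element of the completion is i u. *)
Record is_asymp_completion (S : preorderedSemiRingType) (u : S)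
    (Sbar : porderedSemiRingType) (i : {rmorphism S -> Sbar}) : Prop := {
  completion_monotone : {homo i : x y / x <=s y};
  completion_power_universal : power_universal (i u);
  completion_closed : asymp_closed (i u);
  completion_complete : asymp_complete (i u);
  completion_universal :
    forall (T : porderedSemiRingType) (v : T),
      power_universal v -> asymp_closed v -> asymp_complete v ->
    forall f : {rmorphism S -> T}, {homo f : x y / x <=s y} ->
    exists g : {rmorphism Sbar -> T},
      [/\ {homo g : x y / x <=s y}, f =1 g \o i &
          forall h : {rmorphism Sbar -> T},
            {homo h : x y / x <=s y} -> f =1 h \o i -> h =1 g]
}.

Definition strassen_preorder (S : preorderedSemiRingType) : Prop :=
  (forall m n : nat, (m%:R : S) <=s n%:R <-> (m <= n)%N) /\
  power_universal (2 : S).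

Definition rank (S : preorderedSemiRingType) (s : S) : nat :=
  xget 0%N (minimum_of [set m : nat | s <=s m%:R]).

Definition subrank (S : preorderedSemiRingType) (s : S) : nat :=
  xget 0%N (maximum_of [set m : nat | m%:R <=s s]).

Definition asymp_rank (R : realType) (S : preorderedSemiRingType) (s : S) : R :=
  limn (fun n => (rank (s ^+ n))%:R `^ n%:R^-1).

Definition asymp_subrank (R : realType) (S : preorderedSemiRingType) (s : S) :
    R :=
  limn (fun n => (subrank (s ^+ n))%:R `^ n%:R^-1).

(* The asymptotic completion of nat, through a |-> lim (a n)^(1/n). *)
Definition natbar (R : realType) : set R := [set r | r = 0 \/ 1 <= r].

(* The class of an approximately geometric sequence a of S is the unique element
   x of the completion with i \o a ~ (1, x, x^2, ...): in the model whose
   elements are the ~-classes [a], approximate geometricity of a implies that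
   (i (a n))_n ~ ([a]^n)_n, and x is unique since the completion is closed and
   partially ordered. *)
Definition completion_class (S : preorderedSemiRingType) (u : S)
    (Sbar : porderedSemiRingType) (i : {rmorphism S -> Sbar}) (a : nat -> S) :
    Sbar :=
  xget 0 [set x : Sbar | seq_approx (i u) (i \o a) (geom x)].

(* The embedding of natbar in the completion of S: a real r >= 1 is sent to the
   class of the sequence of the integer parts of r ^ n. *)
Definition natbar_embed (R : realType) (S : preorderedSemiRingType) (u : S)
    (Sbar : porderedSemiRingType) (i : {rmorphism S -> Sbar}) (r : R) : Sbar :=
  if r == 0 then 0
  else completion_class u i (fun n => (Num.truncn (r ^+ n))%:R).

(* Main.v *)
From HB Require Import structures.
Require Import Defs.
From mathcomp Require Import all_boot all_order all_algebra.
From mathcomp Require Import all_classical all_reals all_analysis.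
From mathcomp Require Import ring lra zify.

(* The growth rates of rank and subrank are limits by Fekete's lemma, and the
   subexponential error terms give [i s <= asymp_rank s] and
   [asymp_subrank s <= i s] by closedness of the completion.  Optimality only
   uses the universal property: the nonnegative reals are closed and
   asymptotically complete, so a monotone homomorphism [f] from [S] to the
   nonnegative reals factors through the completion by some [g], and [g] sends
   the class of a real [m >= 1] to [m].  It remains to find [f] with [f s]
   large (for the rank) or small (for the subrank).  As for Strassen's spectral
   theorem, Zorn's lemma yields a maximal extension of the preorder in which a
   prescribed inequality [b <= a] holds; it is total, hence defines [f] by
   Dedekind cuts.  If the inequality cannot be added, then [t a <= 2 t b] for
   some nonzero [t].  The factor 2 is harmless because we compare [s ^+ N] with
   an integer for [N] large. *)

Set Implicit Arguments.
Unset Strict Implicit.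
Unset Printing Implicit Defensive.

Import Order.TTheory GRing.Theory Num.Theory.
Import numFieldNormedType.Exports.

Local Open Scope classical_set_scope.
Local Open Scope ring_scope.

(** * Extensions of a Strassen preorder *)

Section StrassenPreorder.
Variables (S : preorderedSemiRingType) (hS : strassen_preorder S).

Lemma psr_leD (x y z w : S) : x <=s y -> z <=s w -> x + z <=s y + w.
Proof.
move=> xy zw; apply: psr_le_trans (psr_leD2l y _ _ zw).
by rewrite ![_ + z]addrC; apply: psr_leD2l.
Qed.

Lemma psr_leM2r (z x y : S) : x <=s y -> x * z <=s y * z.
Proof. by rewrite ![_ * z]mulrC; apply: psr_leM2l. Qed.

Lemma psr_leM (x y z w : S) : x <=s y -> z <=s w -> x * z <=s y * w.
Proof.
by move=> xy zw; apply: psr_le_trans (psr_leM2l y _ _ zw); apply: psr_leM2r.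
Qed.

Lemma psr_leX (n : nat) (x y : S) : x <=s y -> x ^+ n <=s y ^+ n.
Proof.
move=> xy; elim: n => [|n IHn]; first exact: psr_lexx.
by rewrite !exprS; apply: psr_leM.
Qed.

Lemma strassen_le_nat (m n : nat) : (m%:R : S) <=s n%:R <-> (m <= n)%N.
Proof. exact: hS.1. Qed.

Lemma strassen_ge0 (x : S) : 0 <=s x.
Proof.
rewrite -[0](mulr0 x) -[X in _ <=s X](mulr1 x); apply: psr_leM2l.
exact/(strassen_le_nat 0 1).
Qed.

Lemma strassen_natr_neq0 (n : nat) : (0 < n)%N -> (n%:R : S) != 0.
Proof.
move=> n0; apply/eqP => n_eq0.
have : (n%:R : S) <=s 0%:R by rewrite n_eq0; apply: psr_lexx.
by move/strassen_le_nat; rewrite leqNgt n0.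
Qed.

(** Power universality of [2] is applied to [1 <=s x + 1]; passing to [x + 1] covers [x = 0], where
    it says nothing about [x] itself. *)
Lemma strassen_bound (x : S) : exists K : nat, x <=s K%:R.
Proof.
have [_ _ pu] := hS.2.
have le1 : 1 <=s x + 1.
  by rewrite -[X in X <=s _]add0r; apply: psr_leD (psr_lexx _); apply: strassen_ge0.
have n1 : (1 : S) != 0 by apply: (@strassen_natr_neq0 1).
have nx : x + 1 != 0.
  apply/eqP => x10; move: le1; rewrite x10 => /(strassen_le_nat 1 0).
  by [].
have [k hk] := pu _ _ n1 nx le1.
exists (2 ^ k)%N; rewrite natrX -[X in _ <=s X]mulr1; apply: psr_le_trans hk.
by rewrite -[X in X <=s _]addr0; apply: psr_leD2l; apply: strassen_ge0.
Qed.

Lemma strassen_inv_bound (x : S) : x != 0 -> exists K : nat, 1 <=s K%:R * x.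
Proof.
move=> x0; have [_ _ pu] := hS.2.
have lex : x <=s x + 1.
  by rewrite -[X in X <=s _]addr0; apply: psr_leD2l; apply: strassen_ge0.
have nx : x + 1 != 0.
  apply/eqP => x10.
  have : (1 : S) <=s x + 1.
    rewrite -[X in X <=s _]add0r; apply: psr_leD (psr_lexx _).
    exact: strassen_ge0.
  by rewrite x10 => /(strassen_le_nat 1 0).
have [k hk] := pu _ _ x0 nx lex.
exists (2 ^ k)%N; rewrite natrX; apply: psr_le_trans hk.
rewrite -[X in X <=s _]add0r; apply: psr_leD (psr_lexx _).
exact: strassen_ge0.
Qed.

(** Multiplying [1 <=s K%:R * x] by [1 <=s L%:R * y] bounds [x * y] below, so [x * y = 0] would give
    [1 <=s 0]. *)
Lemma strassen_mulf_neq0 (x y : S) : x != 0 -> y != 0 -> x * y != 0.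
Proof.
move=> /strassen_inv_bound[K hK] /strassen_inv_bound[L hL].
apply/eqP => xy0; have := psr_leM hK hL.
rewrite mulrACA xy0 !mulr0 mulr1 => /(strassen_le_nat 1 0).
by [].
Qed.

Lemma strassen_expf_neq0 (x : S) (n : nat) : x != 0 -> x ^+ n != 0.
Proof.
move=> x0; elim: n => [|n IHn]; first exact: (@strassen_natr_neq0 1).
by rewrite exprS; apply: strassen_mulf_neq0.
Qed.

(** Encoded as a set of pairs so that Zorn's lemma applies to inclusion. The last clause keeps the
    order of the natural numbers from collapsing. *)
Definition strassen_extension (P : set (S * S)) : Prop :=
  [/\ forall x y, x <=s y -> P (x, y),
      forall y x z, P (x, y) -> P (y, z) -> P (x, z),
      forall z x y, P (x, y) -> P (z + x, z + y),
      forall z x y, P (x, y) -> P (z * x, z * y)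
    & forall m n : nat, P (m%:R, n%:R) -> (m <= n)%N].

Lemma strassen_extension_le : strassen_extension [set xy | xy.1 <=s xy.2].
Proof.
split=> /=.
- by [].
- exact: psr_le_trans.
- exact: psr_leD2l.
- exact: psr_leM2l.
- by move=> m n /strassen_le_nat.
Qed.

Section Extension.
Variables (P : set (S * S)) (hP : strassen_extension P).

Lemma extW x y : x <=s y -> P (x, y).
Proof. by case: hP => h _ _ _ _; apply: h. Qed.

Lemma ext_trans y x z : P (x, y) -> P (y, z) -> P (x, z).
Proof. by case: hP => _ h _ _ _; apply: h. Qed.

Lemma extD2l z x y : P (x, y) -> P (z + x, z + y).
Proof. by case: hP => _ _ h _ _; apply: h. Qed.

Lemma extM2l z x y : P (x, y) -> P (z * x, z * y).
Proof. by case: hP => _ _ _ h _; apply: h. Qed.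

Lemma ext_nat (m n : nat) : P (m%:R, n%:R) -> (m <= n)%N.
Proof. by case: hP => _ _ _ _ h; apply: h. Qed.

Lemma extD x y z w : P (x, y) -> P (z, w) -> P (x + z, y + w).
Proof.
move=> xy zw; apply: ext_trans (extD2l y zw).
by rewrite ![_ + z]addrC; apply: extD2l.
Qed.

Lemma extM x y z w : P (x, y) -> P (z, w) -> P (x * z, y * w).
Proof.
move=> xy zw; apply: ext_trans (extM2l y zw).
by rewrite ![_ * z]mulrC; apply: extM2l.
Qed.

(** The summand [z] acts as a catalyst: each use of the hypothesis turns one [x] into [y] and gives
    [z] back. *)
Lemma ext_addI (j : nat) z x y :
  P (z + x, z + y) -> P (z + j%:R * x, z + j%:R * y).
Proof.
move=> h; elim: j => [|j IHj]; first by rewrite !mul0r; apply: extW; exact: psr_lexx.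
rewrite -!natr1 !mulrDl !mul1r.
have -> : z + (j%:R * x + x) = x + (z + j%:R * x) by ring.
apply: (ext_trans (extD2l _ IHj)).
have -> : x + (z + j%:R * y) = j%:R * y + (z + x) by ring.
have -> : z + (j%:R * y + y) = j%:R * y + (z + y) by ring.
exact: extD2l.
Qed.

(** Iterating gives [x + j e <= x] for every [j]. If [1 <= L e] and [x <= K], then [j = L (K + 1)]
    forces [K + 1 <= K]. *)
Lemma ext_addr_irrefl x e : e != 0 -> ~ P (x + e, x).
Proof.
move=> /strassen_inv_bound[L hL] h; have [K hK] := strassen_bound x.
have := @ext_addI (L * K.+1)%N x e 0; rewrite addr0 => /(_ h).
rewrite mulr0 addr0 => {}h.
suff /ext_nat : P (K.+1%:R, K%:R) by rewrite ltnn.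
apply: ext_trans (ext_trans h (extW hK)).
apply: extW; rewrite -[X in X <=s _]add0r; apply: psr_leD.
  exact: strassen_ge0.
rewrite mulnC natrM -mulrA -[X in X <=s _]mulr1.
exact: psr_leM2l.
Qed.

(** The candidate relates [x] to [y] when [x + t a <= y + t b] in [P] for some [t]; witnesses add up
    under transitivity and get multiplied by [z] under multiplication. It can fail to be an
    extension only by reversing two natural numbers, which is the first alternative. *)
Lemma strassen_extension_adjoin (a b : S) :
  (exists t : S, exists m n : nat,
     (m < n)%N /\ P (n%:R + t * a, m%:R + t * b)) \/
  exists2 Q, strassen_extension Q & P `<=` Q /\ Q (b, a).
Proof.
have [h|h] := pselect (exists t : S, exists m n : nat,
  (m < n)%N /\ P (n%:R + t * a, m%:R + t * b)); [by left|right].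
exists [set xy | exists t, P (xy.1 + t * a, xy.2 + t * b)]; last first.
  split; last by exists 1; rewrite !mul1r addrC; apply: extW; exact: psr_lexx.
  by move=> [x y] Pxy; exists 0; rewrite !mul0r !addr0.
split=> /=.
- by move=> x y xy; exists 0; rewrite !mul0r !addr0; apply: extW.
- move=> y x z [t ht] [r hr]; exists (t + r).
  have -> : x + (t + r) * a = r * a + (x + t * a) by ring.
  apply: (ext_trans (extD2l _ ht)).
  have -> : r * a + (y + t * b) = t * b + (y + r * a) by ring.
  apply: (ext_trans (extD2l _ hr)).
  have -> : z + (t + r) * b = t * b + (z + r * b) by ring.
  by apply: extW; exact: psr_lexx.
- by move=> z x y [t ht]; exists t; rewrite -!addrA; apply: extD2l.
- by move=> z x y [t ht]; exists (z * t); rewrite -!mulrA -!mulrDr; apply: extM2l.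
- move=> m n [t ht]; rewrite leqNgt; apply/negP => nm.
  by apply: h; exists t, n, m.
Qed.

End Extension.

(** By maximality, an incomparable pair can be adjoined in neither direction. The two resulting
    obstructions combine to [c + t <= c] with [t != 0], against [ext_addr_irrefl]. *)
Lemma maximal_extension_total (P : set (S * S)) : strassen_extension P ->
  (forall Q, strassen_extension Q -> P `<=` Q -> Q `<=` P) ->
  forall x y, P (x, y) \/ P (y, x).
Proof.
move=> hP Pmax a b.
have [|[Q hQ [PQ Qba]]] := strassen_extension_adjoin hP a b; last first.
  by right; apply: (Pmax Q hQ PQ).
move=> [t [m [n [mn h1]]]].
have [|[Q hQ [PQ Qab]]] := strassen_extension_adjoin hP b a; last first.
  by left; apply: (Pmax Q hQ PQ).
move=> [r [m' [n' [mn' h2]]]]; exfalso.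
have t0 : t != 0.
  apply/eqP => t0; move: h1; rewrite t0 !mul0r !addr0 => /(ext_nat hP).
  by rewrite leqNgt mn.
(* Adding [r] times the first relation to [t] times the second makes the terms
   in [a] and [b] the same on both sides. *)
have h := extD hP (extM2l hP r h1) (extM2l hP t h2).
pose c := r * m%:R + t * m'%:R + r * t * (a + b).
apply: (@ext_addr_irrefl _ hP c t t0).
apply: (ext_trans hP _ (ext_trans hP h _)); last first.
  apply: (extW hP).
  have -> : r * (m%:R + t * b) + t * (m'%:R + r * a) = c by rewrite /c; ring.
  exact: psr_lexx.
apply: (extW hP).
have -> : r * (n%:R + t * a) + t * (n'%:R + r * b) =
          r * n%:R + t * n'%:R + r * t * (a + b) by ring.
(* The surplus [t] comes from the strict inequality [m' < n']. *)
have -> : c + t = r * m%:R + t * (m'.+1)%:R + r * t * (a + b).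
  by rewrite /c -natr1; ring.
apply: psr_leD (psr_lexx _); apply: psr_leD; apply: psr_leM2l.
  by apply/strassen_le_nat; apply: ltnW.
exact/strassen_le_nat.
Qed.

(** Each closure clause involves at most two pairs, which lie in a common member of a chain, so the
    union of a chain of extensions is again one. *)
Lemma exists_maximal_extension (P : set (S * S)) : strassen_extension P ->
  exists Q, [/\ strassen_extension Q, P `<=` Q
    & forall Q', strassen_extension Q' -> Q `<=` Q' -> Q' `<=` Q].
Proof.
move=> hP.
(* The empty set is admitted because [Zorn_bigcup] also covers empty chains. *)
pose good := [set Q | Q = set0 \/ (strassen_extension Q /\ P `<=` Q)].
have [F Fgood Ftot|Q [Qgood Qmax]] := @Zorn_bigcup _ good.
  have [[Q0 FQ0 Q0P]|F0] := pselect (exists2 Q, F Q & Q !=set0); last first.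
    left; rewrite -subset0 => x [Q FQ Qx]; apply: F0.
    by exists Q => //; exists x.
  right.
  have FE Q x : F Q -> Q x -> strassen_extension Q.
    by move=> FQ Qx; have [E|[]//] := Fgood _ FQ; move: Qx; rewrite E.
  have [x0 Q0x0] := Q0P.
  have [E|[hQ0 PQ0]] := Fgood _ FQ0; first by move: Q0x0; rewrite E.
  split; last by move=> x Px; exists Q0 => //; apply: PQ0.
  split.
  - by move=> x y xy; exists Q0 => //; apply: (extW hQ0).
  - move=> y x z [A FA Axy] [B FB Byz].
    have [AB|BA] := Ftot _ _ FA FB.
      exists B => //; apply: (ext_trans (FE _ _ FB Byz) _ Byz); exact: AB.
    exists A => //; apply: (ext_trans (FE _ _ FA Axy) Axy); exact: BA.
  - by move=> z x y [A FA Axy]; exists A => //; apply: (extD2l (FE _ _ FA Axy)).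
  - by move=> z x y [A FA Axy]; exists A => //; apply: (extM2l (FE _ _ FA Axy)).
  - by move=> m n [A FA Amn]; apply: (ext_nat (FE _ _ FA Amn)).
(* Since [P] is nonempty, the empty set is not maximal. *)
have P00 : P (0, 0) by apply: (extW hP); exact: psr_lexx.
have QP : strassen_extension Q /\ P `<=` Q.
  case: Qgood => // Q0; exfalso; apply: (Qmax P); last by right; split.
  rewrite Q0; split; first by move=> x [].
  by move/(_ _ P00).
exists Q; split; [exact: QP.1 | exact: QP.2 |].
move=> Q' hQ' QQ'; apply: contrapT => nQ'Q.
apply: (Qmax Q'); first by split.
by right; split=> //; apply: subset_trans QQ'; exact: QP.2.
Qed.

(** If [b <= a] cannot be imposed, the obstruction weakens to [m + t a <= m + t b]. By [ext_addI]
    the multiplier [t] may be replaced by [j t], and for large [j] the summand [m] is absorbed by a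
    second copy of [j t b], whence the factor 2. *)
Lemma exists_total_extension (a b : S) : b != 0 ->
  (exists2 t : S, t != 0 & t * a <=s t * (2 * b)) \/
  exists P, [/\ strassen_extension P, forall x y, P (x, y) \/ P (y, x)
              & P (b, a)].
Proof.
move=> b0.
have [|[Q hQ [_ Qba]]] := strassen_extension_adjoin strassen_extension_le a b.
  move=> [t [m [n [mn /= h]]]]; left.
  have t0 : t != 0.
    apply/eqP => t0; move: h; rewrite t0 !mul0r !addr0 => /strassen_le_nat.
    by rewrite leqNgt mn.
  have {n mn}h : m%:R + t * a <=s m%:R + t * b.
    apply: psr_le_trans h; apply: psr_leD (psr_lexx _).
    by apply/strassen_le_nat; apply: ltnW.
  have [K hK] := strassen_inv_bound (strassen_mulf_neq0 t0 b0).
  have K0 : (0 < K)%N.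
    rewrite lt0n; apply/eqP => K0; move: hK; rewrite K0 mul0r.
    by move/(strassen_le_nat 1 0).
  (* From [1 <= K t b] it follows that [m <= j t b]; [m.+1] keeps [j] positive. *)
  pose j := (m.+1 * K)%N.
  have j0 : (0 < j)%N by rewrite muln_gt0.
  exists (j%:R * t); first by apply: strassen_mulf_neq0 => //; apply: strassen_natr_neq0.
  have {}h : m%:R + j%:R * (t * a) <=s m%:R + j%:R * (t * b).
    exact: (ext_addI strassen_extension_le j h).
  rewrite -mulrA; apply: (@psr_le_trans _ (m%:R + j%:R * (t * a))).
    rewrite -[X in X <=s _]add0r; apply: psr_leD (psr_lexx _).
    exact: strassen_ge0.
  apply: psr_le_trans h _.
  have -> : j%:R * t * (2 * b) = j%:R * (t * b) + j%:R * (t * b) by ring.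
  apply: psr_leD (psr_lexx _); rewrite /j natrM -mulrA -[X in X <=s _]mulr1.
  by apply: psr_leM hK; apply/strassen_le_nat.
right; have [P [hP QP Pmax]] := exists_maximal_extension hQ.
exists P; split=> //; last exact: QP.
exact: maximal_extension_total hP Pmax.
Qed.

(** A single factor [t] is carried through all powers, [t a^M <= t b^M], and then removed by
    [1 <= L t] and [t <= K], so the constant [L K] does not depend on [M]. *)
Lemma strassen_expX_bound (t a b : S) : t != 0 -> t * a <=s t * b ->
  exists K : nat, forall M : nat, a ^+ M <=s K%:R * b ^+ M.
Proof.
move=> t0 h; have [K hK] := strassen_bound t.
have [L hL] := strassen_inv_bound t0.
exists (L * K)%N => M.
have {}h : t * a ^+ M <=s t * b ^+ M.
  elim: M => [|M IHM]; first exact: psr_lexx.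
  rewrite !exprS mulrA; apply: psr_le_trans (psr_leM2r _ h) _.
  by rewrite mulrAC [_ * (b * _)]mulrCA [_ * b]mulrC; apply: psr_leM2l.
apply: (@psr_le_trans _ (L%:R * t * a ^+ M)).
  by rewrite -[X in X <=s _]mul1r; apply: psr_leM2r.
rewrite natrM -!mulrA; apply: psr_leM2l; apply: psr_le_trans h _.
exact: psr_leM2r.
Qed.

End StrassenPreorder.

(** * Sublinear sequences and exponential growth rates *)

Lemma sublinearP (k : nat -> nat) :
  sublinear k <->
  forall d : nat, exists N, forall n, (N <= n)%N -> (d * k n <= n)%N.
Proof.
split=> [/cvgrPdist_le h d|h].
  have d0 : (0 : rat) < (d.+1%:R)^-1 by rewrite invr_gt0 ltr0n.
  have [N _ hN] := h _ d0; exists N.+1 => n Nn.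
  have n0 : (0 < n)%N by apply: leq_trans Nn.
  have /= := hN n (ltnW Nn); rewrite sub0r normrN ger0_norm ?divr_ge0//.
  rewrite ler_pdivrMr ?ltr0n// mulrC ler_pdivlMr ?ltr0n// -natrM ler_nat.
  by apply: leq_trans; rewrite mulnC leq_mul2l leqnSn orbT.
apply/cvgrPdist_le => e e0.
have [N hN] := h (Num.truncn e^-1).+1.
exists N.+1 => // n /= Nn.
have n0 : (0 < n)%N by apply: leq_trans Nn.
rewrite sub0r normrN ger0_norm ?divr_ge0//.
rewrite ler_pdivrMr ?ltr0n//.
have := hN n (ltnW Nn); rewrite -(ler_nat rat) natrM => hn.
have e1 : e^-1 < (Num.truncn e^-1).+1%:R by apply: truncnS_gt.
rewrite -ler_pdivrMl//; apply: le_trans hn.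
by rewrite ler_wpM2r// ltW.
Qed.

Lemma sublinearD (k l : nat -> nat) :
  sublinear k -> sublinear l -> sublinear (fun n => k n + l n)%N.
Proof.
move=> /sublinearP hk /sublinearP hl; apply/sublinearP => d.
have [N hN] := hk (2 * d)%N; have [M hM] := hl (2 * d)%N.
exists (maxn N M) => n; rewrite geq_max => /andP[/hN h1 /hM h2]; nia.
Qed.

Lemma sublinear_cst (c : nat) : sublinear (fun=> c).
Proof. by apply/sublinearP => d; exists (d * c)%N. Qed.

(** The least admissible [k] at each index works for all [d] at once, so the witnesses for different
    [d] need not be glued. *)
Lemma sublinear_choice (P : nat -> nat -> Prop) :
  (forall n, exists k, P n k) ->
  (forall d, (0 < d)%N ->
     exists N, forall n, (N <= n)%N -> exists2 k, (d * k <= n)%N & P n k) ->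
  exists2 k, sublinear k & forall n, P n (k n).
Proof.
move=> h0 h.
have /choice[k hk] n : exists k, P n k /\ forall l, P n l -> (k <= l)%N.
  have h0' : exists k, `[< P n k >] by have [k /asboolT] := h0 n; exists k.
  case: (ex_minnP h0') => k /asboolP Pk kmin; exists k; split=> // l Pl.
  by apply: kmin; apply/asboolP.
exists k => [|n]; last exact: (hk n).1.
apply/sublinearP => -[|d]; first by exists 0%N.
have [N hN] := h d.+1 isT; exists N => n /hN[l dl Pl].
by apply: leq_trans dl; rewrite leq_mul2l (hk n).2 ?orbT.
Qed.

Section Growth.
Variable R : realType.

(** The limit is the infimum of the quotients [u n / n]. The threshold [n0] is there for the
    subrank, which can vanish at small powers. *)
Lemma fekete (u : nat -> R) (n0 : nat) (C : R) : (0 < n0)%N ->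
  (forall m n, (n0 <= m)%N -> (n0 <= n)%N -> u (m + n)%N <= u m + u n) ->
  (forall n, (n0 <= n)%N -> C * n%:R <= u n) ->
  exists l : R, forall e, 0 < e ->
    exists N, forall n, (N <= n)%N -> `|u n - n%:R * l| <= e * n%:R.
Proof.
move=> n00 usub ulow.
pose A := [set u n / n%:R | n in [set n | (n0 <= n)%N]].
have A0 : A !=set0 by exists (u n0 / n0%:R), n0 => /=.
have Alb : has_lbound A.
  exists C => _ [n /= n0n <-]; rewrite ler_pdivlMr ?ulow// ltr0n.
  exact: leq_trans n0n.
have Ainf : has_inf A by split.
pose l := inf A.
have lu n : (n0 <= n)%N -> n%:R * l <= u n.
  move=> n0n; have n_gt0 : 0 < n%:R :> R by rewrite ltr0n (leq_trans n00).
  rewrite mulrC -ler_pdivlMr//; apply: ge_inf => //; by exists n.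
exists l => e e0.
have e20 : 0 < e / 2 by rewrite divr_gt0.
have [_ [k /= n0k <-] hk] := inf_adherent e20 Ainf.
rewrite -/l in hk.
have k0 : (0 < k)%N by apply: leq_trans n0k.
rewrite ltr_pdivrMr ?ltr0n// in hk.
pose B := \sum_(i < n0 + k) `|u i|.
have uB i : (i < n0 + k)%N -> u i <= B.
  move=> ik; apply: (le_trans (ler_norm _)).
  rewrite /B (bigD1 (Ordinal ik)) //= lerDl.
  by apply: sumr_ge0 => j _; apply: normr_ge0.
have ustep q r : (n0 <= r)%N -> u (q * k + r)%N <= q%:R * u k + u r.
  move=> n0r; elim: q => [|q IHq]; first by rewrite mul0r add0r.
  rewrite mulSn -addnA; apply: le_trans (usub _ _ n0k _) _.
    by apply: leq_trans n0r (leq_addl _ _).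
  by rewrite -natr1 mulrDl mul1r; lra.
(* [D] collects the errors independent of [n]: in the division of [n] by [k] below, the remainder
   [r] lies between [n0] and [n0 + k], so that subadditivity applies to it and [u r <= B]. *)
pose D := B + (n0 + k)%:R * `|l + e / 2|.
have upper n : (n0 <= n)%N -> u n <= n%:R * (l + e / 2) + D.
  move=> n0n; pose q := ((n - n0) %/ k)%N; pose r := (n0 + (n - n0) %% k)%N.
  have nE : n = (q * k + r)%N.
    by rewrite /q /r addnCA -divn_eq subnKC.
  have rk : (r < n0 + k)%N by rewrite /r ltn_add2l ltn_mod.
  have n0r : (n0 <= r)%N by apply: leq_addr.
  rewrite {1}nE; apply: le_trans (ustep q r n0r) _.
  have h1 : q%:R * u k <= q%:R * ((l + e / 2) * k%:R) by rewrite ler_wpM2l// ltW.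
  have h2 := uB _ rk.
  have h3 : - (r%:R * (l + e / 2)) <= (n0 + k)%:R * `|l + e / 2|.
    rewrite -mulrN; apply: (@le_trans _ _ (r%:R * `|l + e / 2|)).
      by rewrite ler_wpM2l// -normrN ler_norm.
    by rewrite ler_wpM2r// ler_nat ltnW.
  rewrite {1}nE natrD natrM /D; lra.
exists (n0 + (Num.truncn (D / (e / 2))).+1)%N => n Nn.
have n0n : (n0 <= n)%N by apply: leq_trans Nn; apply: leq_addr.
have hD : D <= e / 2 * n%:R.
  rewrite mulrC -ler_pdivrMr//; apply: le_trans (ltW (truncnS_gt _)) _.
  by rewrite ler_nat; apply: leq_trans Nn; apply: leq_addl.
rewrite ger0_norm ?subr_ge0 ?lu//; have := upper n n0n; lra.
Qed.

(** This says [f n = exp (n l + o(n))]. Positivity is explicit because [ln] takes a default value at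
    0. *)
Definition exp_growth (f : nat -> nat) (l : R) : Prop :=
  forall e, 0 < e -> exists N, forall n, (N <= n)%N ->
    (0 < f n)%N /\ `|ln (f n)%:R - n%:R * l| <= e * n%:R.

Lemma exp_growth_ge0 (f : nat -> nat) (l : R) : exp_growth f l -> 0 <= l.
Proof.
move=> h; rewrite leNgt; apply/negP => l0.
have e0 : 0 < - l / 2 by rewrite divr_gt0// oppr_gt0.
have [N hN] := h _ e0; have [f0] := hN N.+1 (leqnSn N).
have : 0 <= ln (f N.+1)%:R :> R by rewrite ln_ge0// ler1n.
have : 0 < N.+1%:R * - l by rewrite mulr_gt0// oppr_gt0.
rewrite ler_norml => h1 h2 /andP[h3 h4]; lra.
Qed.

Lemma exp_growth_cvg (f : nat -> nat) (l : R) : exp_growth f l ->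
  (fun n => (f n)%:R `^ n%:R^-1) @ \oo --> expR l.
Proof.
move=> h.
have hl : (fun n => n%:R^-1 * ln (f n)%:R) @ \oo --> l.
  apply/cvgrPdist_le => e /h[N hN]; exists N.+1 => // n /= Nn.
  have n0 : 0 < n%:R :> R by rewrite ltr0n; apply: leq_trans Nn.
  have [_ hn] := hN n (ltnW Nn).
  have -> : l - n%:R^-1 * ln (f n)%:R = n%:R^-1 * - (ln (f n)%:R - n%:R * l).
    by rewrite mulrN mulrBr mulrA mulVf ?gt_eqF// mul1r opprB.
  by rewrite normrM normrN gtr0_norm ?invr_gt0// ler_pdivrMl// [leRHS]mulrC.
have : (fun n => expR (n%:R^-1 * ln (f n)%:R)) @ \oo --> expR l.
  by apply: continuous_cvg hl; apply: continuous_expR.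
apply: cvg_trans; apply: near_eq_cvg.
have [N hN] := h 1 ltr01; exists N => // n /= /hN[f0 _].
by rewrite /powR pnatr_eq0 eqn0Ngt f0.
Qed.

Lemma exp_growth_bounds (f : nat -> nat) (l e : R) : exp_growth f l -> 0 < e ->
  exists N, forall n, (N <= n)%N ->
    expR (n%:R * l) <= expR (e * n%:R) * (f n)%:R /\
    (f n)%:R <= expR (e * n%:R) * expR (n%:R * l).
Proof.
move=> h /h[N hN]; exists N => n /hN[f0].
have f0R : 0 < (f n)%:R :> R by rewrite ltr0n.
rewrite ler_norml => /andP[h1 h2].
rewrite -[(f n)%:R](lnK f0R) -!expRD !ler_expR; split; lra.
Qed.

Lemma truncn_double (x : R) : 1 <= x -> x <= 2 * (Num.truncn x)%:R.
Proof.
move=> x1; have h := truncnS_gt x; rewrite -natr1 in h.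
have : 1 <= (Num.truncn x)%:R :> R by rewrite ler1n truncn_gt0.
lra.
Qed.

(** To base 2, the left side has exponent [n / (2 d) + 1]. Once the integer quotient is at least 4,
    halving [n / d] leaves room for its rounding and for the factor 2. *)
Lemma exp2_div_ge (d n : nat) : (0 < d)%N -> (4 * d <= n)%N ->
  expR (ln 2 / (2 * d%:R) * n%:R) * 2 <= 2 ^+ (n %/ d) :> R.
Proof.
move=> d0 dn.
rewrite -(@lnK R 2) ?posrE// -expRM_natl -expRD ler_expR lnK ?posrE//.
have d0R : 0 < d%:R :> R by rewrite ltr0n.
have hn : n%:R < ((n %/ d)%:R + 1) * d%:R :> R.
  rewrite natr1 -natrM ltr_nat mulSn addnC {1}(divn_eq n d) ltn_add2l ltn_mod.
  exact: d0.
have hq : 4 <= (n %/ d)%:R :> R.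
  by rewrite (ler_nat _ 4) leq_divRL.
have ln20 : 0 < ln 2 :> R by rewrite ln_gt0// ltr1n.
have -> : ln 2 / (2 * d%:R) * n%:R = ln 2 * (n%:R / d%:R / 2) :> R.
  by field; rewrite gt_eqF.
have : n%:R / d%:R < (n %/ d)%:R + 1 :> R by rewrite ltr_pdivrMr.
set q := (_ %/ _)%:R in hq *; set x := _ / _ => hx.
rewrite -[X in _ + X]mulr1 -mulrDr [leRHS]mulrC ler_wpM2l ?ltW//; lra.
Qed.

(** Supplies the eventual bounds required by [sublinear_choice]; the spare factor 2 of [exp2_div_ge]
    pays for the truncation. *)
Lemma exp_growth_truncn (f : nat -> nat) (l : R) (d : nat) :
  exp_growth f l -> 0 <= l -> (0 < d)%N ->
  exists N, forall n, (N <= n)%N ->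
    (f n <= 2 ^ (n %/ d) * Num.truncn (expR l ^+ n))%N /\
    (Num.truncn (expR l ^+ n) <= 2 ^ (n %/ d) * f n)%N.
Proof.
move=> h l0 d0.
have e0 : 0 < ln 2 / (2 * d%:R) :> R.
  by rewrite divr_gt0 ?ln_gt0 ?mulr_gt0 ?ltr0n// ltr1n.
have [N hN] := exp_growth_bounds h e0; exists (maxn N (4 * d)) => n.
rewrite geq_max => /andP[/hN[h1 h2] /(exp2_div_ge d0) h3].
set E := expR (_ / _ * _) in h1 h2 h3.
have E0 : 0 < E by apply: expR_gt0.
rewrite -(ler_nat R) natrM natrX -expRM_natl.
rewrite -(ler_nat R) natrM natrX.
have ge1 : 1 <= expR (n%:R * l) by rewrite -expR0 ler_expR mulr_ge0.
split.
  apply: (le_trans h2); have := truncn_double ge1; set T := (Num.truncn _)%:R => hT.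
  apply: (@le_trans _ _ (E * 2 * T)); first by rewrite -mulrA ler_wpM2l// ltW.
  by rewrite ler_wpM2r.
apply: (@le_trans _ _ (expR (n%:R * l))).
  by rewrite truncn_le expR_ge0.
apply: (le_trans h1); rewrite ler_wpM2r//; lra.
Qed.

Lemma le_of_linear_bound (x y A : R) (M0 : nat) :
  (forall M : nat, (M0 <= M)%N -> x * M%:R <= A + y * M%:R) -> x <= y.
Proof.
move=> h; rewrite leNgt; apply/negP => yx.
have xy0 : 0 < x - y by rewrite subr_gt0.
pose M := (M0 + (Num.truncn (A / (x - y))).+1)%N.
have := h M (leq_addr _ _); apply/negP; rewrite -ltNge.
have : A / (x - y) < M%:R.
  apply: lt_le_trans (truncnS_gt _) _; rewrite ler_nat; exact: leq_addl.
rewrite ltr_pdivrMr//; lra.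
Qed.

(** Logarithms are compared along the multiples of [N]; the constant [ln K] disappears after
    division by [M]. *)
Lemma exp_growth_le (f : nat -> nat) (l : R) (N K c : nat) :
  exp_growth f l -> (0 < N)%N -> (0 < c)%N ->
  (forall M, f (N * M) <= K * c ^ M)%N -> expR l ^+ N <= c%:R.
Proof.
move=> h N0 c0 hf; have c0R : 0 < c%:R :> R by rewrite ltr0n.
have N0R : 0 < N%:R :> R by rewrite ltr0n.
rewrite -[leRHS](lnK c0R) -expRM_natl ler_expR.
apply/ler_addgt0Pr => e e0.
have e0' : 0 < e / N%:R by rewrite divr_gt0.
have [n0 hn0] := h _ e0'.
apply: (@le_of_linear_bound _ _ (ln K%:R) n0) => M nM.
have [|f0] := hn0 (N * M)%N; first by apply: (leq_trans nM); rewrite leq_pmull.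
have K0 : (0 < K)%N.
  rewrite lt0n; apply/eqP => K0; have := hf M; rewrite K0 mul0n leqn0 => /eqP E.
  by rewrite E in f0.
have : ln (f (N * M)%N)%:R <= ln K%:R + M%:R * ln c%:R :> R.
  rewrite mulr_natl -lnXn// -lnM ?posrE ?exprn_gt0 ?ltr0n// -natrX -natrM.
  by rewrite ler_ln ?posrE ?ltr0n ?muln_gt0 ?K0 ?expn_gt0 ?c0// ler_nat hf.
have -> : e / N%:R * (N * M)%:R = e * M%:R.
  by rewrite natrM; field; rewrite gt_eqF.
rewrite natrM ler_norml => h1 /andP[h2 h3]; lra.
Qed.

Lemma exp_growth_ge (f : nat -> nat) (l : R) (N K c : nat) :
  exp_growth f l -> (0 < N)%N -> (0 < c)%N ->
  (forall M, c ^ M <= f (N * M + K))%N -> c%:R <= expR l ^+ N.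
Proof.
move=> h N0 c0 hf; have c0R : 0 < c%:R :> R by rewrite ltr0n.
have N0R : 0 < N%:R :> R by rewrite ltr0n.
rewrite -[leLHS](lnK c0R) -expRM_natl ler_expR.
apply/ler_addgt0Pr => e e0.
have e0' : 0 < e / N%:R by rewrite divr_gt0.
have [n0 hn0] := h _ e0'.
apply: (@le_of_linear_bound _ _ (K%:R * l + e / N%:R * K%:R) n0) => M nM.
have [|f0] := hn0 (N * M + K)%N.
  by apply: (leq_trans nM); apply: leq_trans (leq_addr _ _); rewrite leq_pmull.
have : M%:R * ln c%:R <= ln (f (N * M + K)%N)%:R :> R.
  rewrite mulr_natl -lnXn// -natrX.
  by rewrite ler_ln ?posrE ?ltr0n ?expn_gt0 ?c0// ler_nat hf.
have -> : e / N%:R * (N * M + K)%:R = e * M%:R + e / N%:R * K%:R.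
  by rewrite natrD natrM; field; rewrite gt_eqF.
rewrite natrD natrM ler_norml => h1 /andP[h2 h3]; lra.
Qed.

End Growth.

(** * The nonnegative reals *)

Record nnreal (R : realType) := NNReal
  { nnreal_val : R; nnreal_ge0 : nnreal_val \is Num.nneg }.

HB.instance Definition _ (R : realType) := [isSub for @nnreal_val R].
HB.instance Definition _ (R : realType) := [Choice of nnreal R by <:].
HB.instance Definition _ (R : realType) :=
  [SubChoice_isSubComNzSemiRing of nnreal R by <:].

Section NNReal.
Variable R : realType.

Definition nnreal_le (x y : nnreal R) : Prop := nnreal_val x <= nnreal_val y.

Lemma nnreal_lexx x : nnreal_le x x.
Proof. exact: lexx. Qed.

Lemma nnreal_le_trans y x z : nnreal_le x y -> nnreal_le y z -> nnreal_le x z.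
Proof. exact: le_trans. Qed.

Lemma nnreal_leD2l z x y : nnreal_le x y -> nnreal_le (z + x) (z + y).
Proof. by rewrite /nnreal_le /= lerD2l. Qed.

Lemma nnreal_leM2l z x y : nnreal_le x y -> nnreal_le (z * x) (z * y).
Proof. by move=> xy; apply: ler_wpM2l => //; apply: nnreal_ge0. Qed.

Lemma nnreal_le_anti x y : nnreal_le x y -> nnreal_le y x -> x = y.
Proof. by move=> xy yx; apply/val_inj/le_anti/andP. Qed.

HB.instance Definition _ := isPreorderedSemiRing.Build (nnreal R)
  nnreal_lexx nnreal_le_trans nnreal_leD2l nnreal_leM2l.
HB.instance Definition _ :=
  PreorderedSemiRing_isPOrdered.Build (nnreal R) nnreal_le_anti.

Lemma nnreal_valM (x y : nnreal R) :
  nnreal_val (x * y) = nnreal_val x * nnreal_val y.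
Proof. by []. Qed.

Lemma nnreal_valX (x : nnreal R) (n : nat) :
  nnreal_val (x ^+ n) = nnreal_val x ^+ n.
Proof. by elim: n => // n IHn; rewrite !exprS -IHn. Qed.

Lemma nnreal_val_nat (n : nat) : nnreal_val (n%:R : nnreal R) = n%:R.
Proof. by elim: n => // n IHn; rewrite !mulrSr -IHn. Qed.

Lemma nnreal_val_ge0 (x : nnreal R) : 0 <= nnreal_val x.
Proof. exact: nnreal_ge0. Qed.

Lemma nnreal_val_gt0 (x : nnreal R) : x != 0 -> 0 < nnreal_val x.
Proof. by rewrite lt0r nnreal_val_ge0 andbT. Qed.

Lemma nnreal_leE (x y : nnreal R) :
  (x <=s y) = (nnreal_val x <= nnreal_val y) :> Prop.
Proof. by []. Qed.

Definition nnrealE := (nnreal_leE, nnreal_valM, nnreal_valX, nnreal_val_nat).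

Lemma nnreal_power_universal : power_universal (2 : nnreal R).
Proof.
split.
- apply/eqP => /(congr1 (@nnreal_val R)); rewrite nnreal_val_nat => /eqP.
  by rewrite pnatr_eq0.
- by rewrite -[1]/(1%:R) !nnrealE ler_nat.
- move=> x y /nnreal_val_gt0 x0 _ _.
  exists (Num.truncn (nnreal_val y / nnreal_val x)).+1.
  rewrite !nnrealE -ler_pdivrMr//; apply: le_trans (ltW (truncnS_gt _)) _.
  by rewrite -natrX ler_nat ltnW// ltn_expl.
Qed.

(** If [y < x], logarithms give [n (ln x - ln y) <= k n * ln 2], which contradicts sublinearity;
    [y = 0] is excluded at index 1. *)
Lemma nnreal_asymp_closed : asymp_closed (2 : nnreal R).
Proof.
move=> x y [k /sublinearP ksub h].
rewrite nnreal_leE leNgt; apply/negP => yx.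
have x0 : 0 < nnreal_val x := le_lt_trans (nnreal_val_ge0 y) yx.
have y0 : 0 < nnreal_val y.
  rewrite lt0r nnreal_val_ge0 andbT; apply/eqP => y0.
  have := h 1%N; rewrite /geom !expr1 !nnrealE y0 mulr0.
  by rewrite leNgt x0.
pose r := ln (nnreal_val x) - ln (nnreal_val y).
have r0 : 0 < r by rewrite subr_gt0 ltr_ln.
have ln20 : 0 < ln 2 :> R by rewrite ln_gt0// ltr1n.
pose d := (Num.truncn (2 * ln 2 / r)).+1.
have hd : 2 * ln 2 < d%:R * r by rewrite -ltr_pdivrMr// truncnS_gt.
have [N hN] := ksub d.
have := hN N.+1 (leqnSn N); rewrite -(ler_nat R) natrM => hk.
have := h N.+1; rewrite /geom !nnrealE.
rewrite -ler_ln ?posrE ?mulr_gt0 ?exprn_gt0//.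
rewrite lnM ?posrE ?exprn_gt0// !lnXn// -!(mulr_natl (ln _)) => {}h.
have k0 : 0 <= (k N.+1)%:R :> R by [].
have n0 : 0 < N.+1%:R :> R by rewrite ltr0n.
have h1 : (k N.+1)%:R * (2 * ln 2) <= (k N.+1)%:R * (d%:R * r) by rewrite ler_wpM2l// ltW.
have h2 : d%:R * (k N.+1)%:R * r <= N.+1%:R * r by rewrite ler_wpM2r// ltW.
have h3 : 0 < N.+1%:R * r by rewrite mulr_gt0.
rewrite /r in h1 h2 h3; lra.
Qed.

(** The logarithms [b] are additive up to the error [c]. Estimating [b (m * n)] in two ways gives
    [(b n - c n) / n <= (b m + c m) / m], so the supremum [l] of the left sides separates the two
    families and [expR l] is the limit. *)
Lemma nnreal_asymp_complete : asymp_complete (2 : nnreal R).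
Proof.
move=> a a0 [[[k _ h] _]|[_ [k ksub h]]].
  have := h 1%N; rewrite /geom expr1 nnreal_leE mulr0 leNgt.
  by rewrite nnreal_val_gt0.
pose b n := ln (nnreal_val (a n)).
have apos n : 0 < nnreal_val (a n) by apply: nnreal_val_gt0.
pose c n : R := (k n)%:R * ln 2.
have ln20 : 0 < ln 2 :> R by rewrite ln_gt0// ltr1n.
have hb (t n : nat) : (0 < t)%N ->
    t%:R * b n <= t%:R * c n + b (t * n)%N /\
    b (t * n)%N <= t%:R * c n + t%:R * b n.
  move=> t0; have := h t (fun=> n) t0.
  rewrite prodr_const sum_nat_const sum_nat_const card_ord !nnrealE.
  move=> [h1 h2]; rewrite -ler_ln ?posrE ?mulr_gt0 ?exprn_gt0// in h1.
  rewrite -ler_ln ?posrE ?mulr_gt0 ?exprn_gt0// in h2.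
  rewrite lnM ?posrE ?exprn_gt0// !lnXn// -!(mulr_natl (ln _)) natrM in h1.
  rewrite lnM ?posrE ?exprn_gt0// !lnXn// -!(mulr_natl (ln _)) natrM in h2.
  by rewrite mulrA.
have cross (m n : nat) : (0 < m)%N -> (0 < n)%N ->
    (b n - c n) / n%:R <= (b m + c m) / m%:R.
  move=> m0 n0; rewrite ler_pdivrMr ?ltr0n// mulrAC ler_pdivlMr ?ltr0n//.
  have [h1 _] := hb m n m0; have [_ h2] := hb n m n0.
  rewrite mulnC in h2; lra.
pose A := [set (b n - c n) / n%:R | n in [set n | (0 < n)%N]].
have A0 : A !=set0 by exists ((b 1%N - c 1%N) / 1%:R), 1%N.
have Aub m : (0 < m)%N -> ubound A ((b m + c m) / m%:R).
  by move=> m0 _ [n /= n0 <-]; apply: cross.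
pose l := sup A.
have hl n : (0 < n)%N -> b n <= c n + n%:R * l /\ n%:R * l <= c n + b n.
  move=> n0; have n0R : 0 < n%:R :> R by rewrite ltr0n.
  have : (b n - c n) / n%:R <= l.
    by apply: ub_le_sup; [exists ((b 1%N + c 1%N) / 1%:R); apply: Aub|exists n].
  have : l <= (b n + c n) / n%:R by apply: ge_sup => //; apply: Aub.
  rewrite ler_pdivrMr// ler_pdivlMr//; lra.
have s0 : expR l \is Num.nneg by rewrite nnegrE expR_ge0.
(* The index 0 is not covered by [hl]; doubling [k] takes care of it. *)
have hl2 n : b n <= 2 * c n + n%:R * l /\ n%:R * l <= 2 * c n + b n.
  have c0 : 0 <= c n by rewrite mulr_ge0// ltW.
  case: n c0 => [|n] c0; last by have := hl n.+1 isT; lra.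
  have := hb 2%N 0%N isT; rewrite muln0 mul0r; lra.
exists (NNReal s0); split; exists (fun n => k n + k n)%N; try exact: sublinearD.
  move=> n; rewrite /geom !nnrealE /= -(lnK (apos n)) -/(b n).
  rewrite -[X in X ^+ (k n + k n)](@lnK R 2) ?posrE// -!expRM_natl -expRD ler_expR.
  rewrite natrD; have := hl2 n; rewrite /c; lra.
move=> n; rewrite /geom !nnrealE /= -(lnK (apos n)) -/(b n).
rewrite -[X in X ^+ (k n + k n)](@lnK R 2) ?posrE// -!expRM_natl -expRD ler_expR.
rewrite natrD; have := hl2 n; rewrite /c; lra.
Qed.

End NNReal.

(** * Real functionals from total extensions *)

Section TotalExtension.
Variables (R : realType) (S : preorderedSemiRingType).
Hypothesis hS : strassen_preorder S.
Variable P : set (S * S).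
Hypotheses (hP : strassen_extension P) (Ptot : forall x y, P (x, y) \/ P (y, x)).

(** The Dedekind cut of [x], with the denominator moved to the side of [x] as [S] has no
    fractions. *)
Definition total_ext_val (x : S) : R :=
  sup [set r : R | exists p N : nat,
    [/\ (0 < N)%N, P (p%:R, N%:R * x) & r = p%:R / N%:R]].

Lemma total_ext_val_ub (x : S) (N q : nat) : (0 < N)%N -> P (N%:R * x, q%:R) ->
  ubound [set r : R | exists p N : nat,
    [/\ (0 < N)%N, P (p%:R, N%:R * x) & r = p%:R / N%:R]] (q%:R / N%:R).
Proof.
move=> N0 h _ [p [M [M0 h' ->]]].
rewrite ler_pdivrMr ?ltr0n// mulrAC ler_pdivlMr ?ltr0n// -!natrM ler_nat.
apply: (ext_nat hP); rewrite !natrM.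
apply: (ext_trans hP _ (extM hP h (extW hP (psr_lexx M%:R)))).
have -> : N%:R * x * M%:R = M%:R * x * N%:R by ring.
exact: (extM hP h' (extW hP (psr_lexx _))).
Qed.

Lemma total_ext_val_le (x : S) (N q : nat) : (0 < N)%N -> P (N%:R * x, q%:R) ->
  N%:R * total_ext_val x <= q%:R.
Proof.
move=> N0 h; rewrite mulrC -ler_pdivlMr ?ltr0n//; apply: ge_sup.
  exists 0, 0%N, 1%N; split; rewrite ?mul0r//.
  exact/(extW hP)/(strassen_ge0 hS).
exact: total_ext_val_ub.
Qed.

Lemma total_ext_val_ge (x : S) (N p : nat) : (0 < N)%N -> P (p%:R, N%:R * x) ->
  p%:R <= N%:R * total_ext_val x.
Proof.
move=> N0 h; rewrite mulrC -ler_pdivrMr ?ltr0n//; apply: ub_le_sup.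
  have [K hK] := strassen_bound hS x.
  exists (K%:R / 1%:R); apply: total_ext_val_ub => //.
  by rewrite mul1r; apply: (extW hP).
by exists p, N.
Qed.

(** Totality enters here: the largest [p] below [N x] exists by boundedness, and since [p + 1] is
    not below [N x], it is above. *)
Lemma total_ext_floor (x : S) (N : nat) :
  exists p : nat, P (p%:R, N%:R * x) /\ P (N%:R * x, p.+1%:R).
Proof.
have [K hK] := strassen_bound hS (N%:R * x).
have h0 : exists p : nat, `[< P (p%:R, N%:R * x) >].
  by exists 0%N; apply/asboolP/(extW hP)/(strassen_ge0 hS).
have hub p : `[< P (p%:R, N%:R * x) >] -> (p <= K)%N.
  by move=> /asboolP h; apply: (ext_nat hP); apply: (ext_trans hP h (extW hP hK)).
case: (ex_maxnP h0 hub) => p /asboolP hp pmax; exists p; split=> //.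
have [h|//] := Ptot p.+1%:R (N%:R * x).
by have := pmax p.+1; rewrite ltnn => /(_ (asboolT h)).
Qed.

Lemma total_ext_val_approx (x : S) (N : nat) : (0 < N)%N -> exists p : nat,
  [/\ P (p%:R, N%:R * x), P (N%:R * x, p.+1%:R),
      p%:R <= N%:R * total_ext_val x & N%:R * total_ext_val x <= p%:R + 1].
Proof.
move=> N0; have [p [h1 h2]] := total_ext_floor x N; exists p; split=> //.
  exact: total_ext_val_ge.
by rewrite natr1; apply: total_ext_val_le.
Qed.

Lemma total_ext_val_homo (x y : S) : P (x, y) ->
  total_ext_val x <= total_ext_val y.
Proof.
move=> xy; apply: (@le_of_linear_bound _ _ _ 1 1) => N N0.
have [p [h1 _ _ h2]] := total_ext_val_approx x N0.
rewrite mulrC; apply: (le_trans h2).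
rewrite addrC lerD2l mulrC; apply: total_ext_val_ge => //.
by apply: (ext_trans hP h1); apply: (extM2l hP).
Qed.

Lemma total_ext_val_nat (n : nat) : total_ext_val n%:R = n%:R.
Proof.
have h : P (1%:R * n%:R, n%:R) by rewrite mul1r; apply/(extW hP)/psr_lexx.
have h' : P (n%:R, 1%:R * n%:R) by rewrite mul1r; apply/(extW hP)/psr_lexx.
have := @total_ext_val_le _ 1 _ isT h; have := @total_ext_val_ge _ 1 _ isT h'.
by rewrite !mul1r => h1 h2; apply/le_anti/andP.
Qed.

Lemma total_ext_val_ge0 (x : S) : 0 <= total_ext_val x.
Proof.
have := total_ext_val_homo (extW hP (strassen_ge0 hS x)).
by rewrite (total_ext_val_nat 0).
Qed.

Lemma total_ext_valD (x y : S) :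
  total_ext_val (x + y) = total_ext_val x + total_ext_val y.
Proof.
suff h N : (0 < N)%N ->
    total_ext_val (x + y) * N%:R <= 2 + (total_ext_val x + total_ext_val y) * N%:R
    /\ (total_ext_val x + total_ext_val y) * N%:R <= 2 + total_ext_val (x + y) * N%:R.
  by apply/le_anti/andP; split; apply: (@le_of_linear_bound _ _ _ 2 1) => N /h[].
move=> N0.
have [p [p1 p2 p3 p4]] := total_ext_val_approx x N0.
have [q [q1 q2 q3 q4]] := total_ext_val_approx y N0.
have := extD hP p1 q1; rewrite -natrD -mulrDr => /(total_ext_val_ge N0) h1.
have := extD hP p2 q2; rewrite -natrD -mulrDr => /(total_ext_val_le N0) h2.
move: h1 h2; rewrite !natrD -(natr1 p) -(natr1 q) => h1 h2; lra.
Qed.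

(** Multiplying the approximations at scale [N] compares both sides at scale [N * N] with an error
    of at most [N (a + b) + 1]; division by [N] leaves the constant [a + b + 1]. *)
Lemma total_ext_valM (x y : S) :
  total_ext_val (x * y) = total_ext_val x * total_ext_val y.
Proof.
set a := total_ext_val x; set b := total_ext_val y; set c := total_ext_val (x * y).
suff h N : (0 < N)%N -> c * N%:R <= (a + b + 1) + a * b * N%:R
    /\ a * b * N%:R <= (a + b + 1) + c * N%:R.
  by apply/le_anti/andP; split; apply: (@le_of_linear_bound _ _ _ (a + b + 1) 1) => N /h[].
move=> N0.
have [p [p1 p2 p3 p4]] := total_ext_val_approx x N0.
have [q [q1 q2 q3 q4]] := total_ext_val_approx y N0.
rewrite -/a -/b in p3 p4 q3 q4.
have NN0 : (0 < N * N)%N by rewrite muln_gt0 N0.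
have := extM hP p1 q1; rewrite -natrM mulrACA -natrM => /(total_ext_val_ge NN0).
have := extM hP p2 q2; rewrite -natrM mulrACA -natrM => /(total_ext_val_le NN0).
rewrite -/c !natrM -(natr1 p) -(natr1 q).
have N1 : 1 <= N%:R :> R by rewrite ler1n.
have N0R : 0 < N%:R :> R by rewrite ltr0n.
have p0 : 0 <= p%:R :> R by [].
have q0 : 0 <= q%:R :> R by [].
move: (p%:R) (q%:R) (N%:R) p0 q0 p3 p4 q3 q4 N1 N0R => P' Q' M p0 q0 p3 p4 q3 q4 N1 N0R h2 h1.
have h3 : P' * Q' <= (M * a) * (M * b) by apply: ler_pM.
have h4 : (M * a) * (M * b) <= (P' + 1) * (Q' + 1).
  by apply: ler_pM => //; [apply: le_trans p3|apply: le_trans q3].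
split; rewrite -(ler_pM2l N0R); lra.
Qed.

Lemma exists_monotone_functional :
  exists f : {rmorphism S -> nnreal R}, forall x y, P (x, y) -> f x <=s f y.
Proof.
have ge0 x : total_ext_val x \is Num.nneg by rewrite nnegrE total_ext_val_ge0.
pose phi x : nnreal R := NNReal (ge0 x).
have phi0 : nmod_morphism phi.
  split; first by apply/val_inj; exact: (total_ext_val_nat 0).
  by move=> x y; apply/val_inj; exact: total_ext_valD.
have phi1 : monoid_morphism phi.
  split; first by apply/val_inj; exact: (total_ext_val_nat 1).
  by move=> x y; apply/val_inj; exact: total_ext_valM.
pose mA := GRing.isNmodMorphism.Build S (nnreal R) phi phi0.
pose mM := GRing.isMonoidMorphism.Build S (nnreal R) phi phi1.
pose f : {rmorphism S -> nnreal R} := HB.pack phi mA mM.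
by exists f => x y xy; rewrite nnreal_leE; apply: total_ext_val_homo.
Qed.

End TotalExtension.

Lemma exists_separating_functional (R : realType) (S : preorderedSemiRingType)
    (hS : strassen_preorder S) (a b : S) : b != 0 ->
  (exists2 t : S, t != 0 & t * a <=s t * (2 * b)) \/
  exists2 f : {rmorphism S -> nnreal R},
    {homo f : x y / x <=s y} & f b <=s f a.
Proof.
move=> /(exists_total_extension hS a)[|[P [hP Ptot Pba]]]; [by left|right].
have [f hf] := exists_monotone_functional R hS hP Ptot.
by exists f => [x y xy|]; apply: hf => //; apply: (extW hP).
Qed.

(** * Rank and subrank *)

Section RankGrowth.
Variables (R : realType) (S : preorderedSemiRingType).
Hypothesis hS : strassen_preorder S.

(** [strassen_bound] makes the set of upper bounds nonempty, so [xget] does not return its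
    default. *)
Lemma rank_min (x : S) :
  x <=s (rank x)%:R /\ forall m : nat, x <=s m%:R -> (rank x <= m)%N.
Proof.
have [K hK] := strassen_bound hS x.
have hex : exists m : nat, `[< x <=s m%:R >] by exists K; apply/asboolP.
case: (ex_minnP hex) => m /asboolP hm mmin.
have : minimum_of [set m : nat | x <=s m%:R] (rank x).
  apply: (xgetPex 0%N); exists m; split=> //= j hj.
  by rewrite leEnat; apply/mmin/asboolP.
by move=> [/= h1 h2]; split=> // j hj; apply: h2.
Qed.

Lemma subrank_max (x : S) :
  (subrank x)%:R <=s x /\ forall m : nat, m%:R <=s x -> (m <= subrank x)%N.
Proof.
have [K hK] := strassen_bound hS x.
have hex : exists m : nat, `[< m%:R <=s x >].
  by exists 0%N; apply/asboolP/(strassen_ge0 hS).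
have hub m : `[< m%:R <=s x >] -> (m <= K)%N.
  move=> /asboolP h; apply/(strassen_le_nat hS).
  exact: psr_le_trans h hK.
case: (ex_maxnP hex hub) => m /asboolP hm mmax.
have : maximum_of [set m : nat | m%:R <=s x] (subrank x).
  apply: (xgetPex 0%N); exists m; split=> //= j hj.
  by rewrite leEnat; apply/mmax/asboolP.
by move=> [/= h1 h2]; split=> // j hj; apply: h2.
Qed.

Lemma rank_gt0 (x : S) : x != 0 -> (0 < rank x)%N.
Proof.
move=> /(strassen_inv_bound hS)[K hK]; rewrite lt0n; apply/eqP => r0.
have [h _] := rank_min x; rewrite r0 in h.
have := psr_le_trans _ _ _ hK (psr_leM2l K%:R _ _ h).
by rewrite mulr0 => /(strassen_le_nat hS 1 0).
Qed.

Lemma rank_exp_growth (s : S) : s != 0 ->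
  exists l : R, exp_growth (fun n => rank (s ^+ n)) l.
Proof.
move=> s0.
have rpos n : (0 < rank (s ^+ n))%N by apply/rank_gt0/strassen_expf_neq0.
have [||l hl] := @fekete R (fun n => ln (rank (s ^+ n))%:R) 1 0 isT.
- move=> m n _ _; rewrite -lnM ?posrE ?ltr0n// -natrM.
  rewrite ler_ln ?posrE ?ltr0n ?muln_gt0 ?rpos// ler_nat.
  apply: (rank_min _).2; rewrite exprD natrM.
  by apply: psr_leM; apply: (rank_min _).1.
- by move=> n _; rewrite mul0r ln_ge0// ler1n.
by exists l => e /hl[N hN]; exists N => n /hN.
Qed.

(** With [n = p q + r], the factor [s^(p q) >= 2^q] eventually outweighs the constant needed for
    [s^r]. Hence the subranks of high powers are positive and have logarithms. *)
Lemma strassen_expX_eventually_ge1 (s : S) (p : nat) : 2 <=s s ^+ p ->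
  s != 0 /\ exists n0, forall n, (n0 <= n)%N -> 1 <=s s ^+ n.
Proof.
move=> h.
have s0 : s != 0.
  apply/eqP => s0; move: h; rewrite s0 expr0n.
  by case: (p == 0%N) => /= [/(strassen_le_nat hS 2 1)|/(strassen_le_nat hS 2 0)].
split=> //.
have p0 : (0 < p)%N.
  by rewrite lt0n; apply/eqP => p0; move: h; rewrite p0 => /(strassen_le_nat hS 2 1).
have [K hK] := strassen_inv_bound hS (strassen_expf_neq0 hS p s0).
have h2 q : (2 ^ q)%:R <=s s ^+ (p * q).
  by rewrite natrX exprM; apply: psr_leX.
(* [s ^+ r] is bounded below for each of the finitely many remainders [r < p]. *)
have [L hL] : exists L : nat, forall r, (r < p)%N -> 1 <=s L%:R * s ^+ r.
  have /choice[g hg] r : exists L : nat, 1 <=s L%:R * s ^+ r.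
    exact/(strassen_inv_bound hS)/(strassen_expf_neq0 hS).
  exists (\sum_(r < p) g r)%N => r rp.
  apply: psr_le_trans (hg r) _; apply: psr_leM2r; apply/(strassen_le_nat hS).
  by rewrite (bigD1 (Ordinal rp))//= leq_addr.
exists (p * L)%N => n nL.
have nE : n = (p * (n %/ p) + n %% p)%N by rewrite mulnC -divn_eq.
rewrite nE exprD.
apply: psr_le_trans (hL _ (ltn_pmod n p0)) _; apply: psr_leM2r.
apply: psr_le_trans _ (h2 _); apply/(strassen_le_nat hS).
have Lq : (L <= n %/ p)%N by rewrite leq_divRL// mulnC.
exact: leq_trans Lq (ltnW (ltn_expl _ (ltnSn 1))).
Qed.

(** The subrank is supermultiplicative, so Fekete's lemma applies to minus its logarithm, bounded
    below through [s <= K]. *)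
Lemma subrank_exp_growth (s : S) (p : nat) : 2 <=s s ^+ p ->
  exists l : R, exp_growth (fun n => subrank (s ^+ n)) l.
Proof.
move=> /strassen_expX_eventually_ge1[s0 [n0 hn0]].
have qpos n : (n0.+1 <= n)%N -> (0 < subrank (s ^+ n))%N.
  by move=> /ltnW/hn0; apply: ((subrank_max _).2 1%N).
have [K hK] := strassen_bound hS s.
have [||l hl] := @fekete R (fun n => - ln (subrank (s ^+ n))%:R) n0.+1 (- ln K%:R) isT.
- move=> m n hm hn; rewrite -opprD lerN2.
  have hmn : (n0 < m + n)%N by apply: (leq_trans hm); rewrite leq_addr.
  rewrite -lnM ?posrE ?ltr0n ?qpos// -natrM.
  rewrite ler_ln ?posrE ?ltr0n ?muln_gt0 ?qpos// ler_nat.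
  apply: (subrank_max _).2; rewrite exprD natrM.
  by apply: psr_leM; apply: (subrank_max _).1.
- move=> n hn; rewrite mulNr lerN2 mulr_natr.
  have h : (subrank (s ^+ n) <= K ^ n)%N.
    apply/(strassen_le_nat hS); apply: psr_le_trans (subrank_max _).1 _.
    by rewrite natrX; apply: psr_leX.
  have K0 : (0 < K)%N.
    move: (leq_trans (qpos n hn) h); rewrite expn_gt0 => /orP[//|/eqP n_eq0].
    by rewrite n_eq0 in hn.
  by rewrite -lnXn ?ltr0n// -natrX ler_ln ?posrE ?ltr0n ?qpos ?expn_gt0 ?K0// ler_nat.
exists (- l) => e /hl[N hN]; exists (maxn N n0.+1) => n.
rewrite geq_max => /andP[/hN h /qpos q0]; split=> //.
by move: h; rewrite -opprD normrN mulrN opprK.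
Qed.

End RankGrowth.

Lemma exists_pow_gap (R : realType) (x y c : R) : 0 < x -> x < y -> 0 < c ->
  exists2 N : nat, (0 < N)%N & c * x ^+ N < y ^+ N.
Proof.
move=> x0 xy c0; have y0 := lt_trans x0 xy.
have r0 : 0 < ln y - ln x by rewrite subr_gt0 ltr_ln.
exists (Num.truncn (ln c / (ln y - ln x))).+1 => //.
have := truncnS_gt (ln c / (ln y - ln x)); set N := _.+1 => h.
rewrite ltr_pdivrMr// in h.
rewrite -ltr_ln ?posrE ?mulr_gt0 ?exprn_gt0// lnM ?posrE ?exprn_gt0//.
rewrite !lnXn// -!(mulr_natl (ln _)); lra.
Qed.

(** * The asymptotic completion *)

Lemma seq_lesssim_trans (T : preorderedSemiRingType) (u : T) (a b c : nat -> T) :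
  seq_lesssim u a b -> seq_lesssim u b c -> seq_lesssim u a c.
Proof.
move=> [k ksub hk] [l lsub hl]; exists (fun n => k n + l n)%N.
  exact: sublinearD.
move=> n; apply: psr_le_trans (hk n) _; rewrite exprD -mulrA.
exact: psr_leM2l.
Qed.

Lemma seq_lesssim_map (T U : preorderedSemiRingType) (f : {rmorphism T -> U})
    (u : T) (a b : nat -> T) : {homo f : x y / x <=s y} ->
  seq_lesssim u a b -> seq_lesssim (f u) (f \o a) (f \o b).
Proof.
by move=> fhomo [k ksub hk]; exists k => // n /=; rewrite -rmorphXn -rmorphM; apply: fhomo.
Qed.

Lemma geom_map (T U : preorderedSemiRingType) (f : {rmorphism T -> U}) (x : T) :
  f \o geom x = geom (f x).
Proof. by apply/funext => n /=; rewrite /geom rmorphXn. Qed.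

Lemma natseq_map (T U : preorderedSemiRingType) (f : {rmorphism T -> U})
  (g : nat -> nat) : f \o (fun n => (g n)%:R) = (fun n => (g n)%:R).
Proof. by apply/funext => n /=; rewrite rmorph_nat. Qed.

Section Completion.
Variables (R : realType) (S : preorderedSemiRingType).
Hypothesis hS : strassen_preorder S.
Variables (Sbar : porderedSemiRingType) (i : {rmorphism S -> Sbar}).
Hypothesis hi : is_asymp_completion 2 i.

Lemma completion_le_nat (m n : nat) : (m <= n)%N -> (m%:R : Sbar) <=s n%:R.
Proof.
move=> mn; rewrite -!(rmorph_nat i); apply: (completion_monotone hi).
exact/(strassen_le_nat hS).
Qed.

Lemma completion_natr_neq0 (n : nat) : (0 < n)%N -> (n%:R : Sbar) != 0.
Proof.
move=> n0; apply/eqP => E.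
have E1 : (1 : Sbar) = 0.
  apply: psr_le_anti; last exact: (completion_le_nat (leq0n 1)).
  by rewrite -E; apply: (completion_le_nat n0).
have [/eqP + _ _] := completion_power_universal hi.
by apply; rewrite -[i 2]mulr1 E1 mulr0.
Qed.

(** Each truncation loses at most a factor 2, so the constant error sequence 1 suffices. *)
Lemma natbar_approx_geometric (m : R) : 1 <= m ->
  approx_geometric (2 : Sbar) (fun n => (Num.truncn (m ^+ n))%:R).
Proof.
move=> m1; right.
have mX n : 1 <= m ^+ n by apply: exprn_ege1.
split; first by move=> n; apply: completion_natr_neq0; rewrite truncn_gt0.
exists (fun=> 1%N); first exact: sublinear_cst.
move=> t n t0; rewrite sum_nat_const card_ord muln1.
rewrite -!natr_prod -!natrX -!natrM; split; apply: completion_le_nat.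
  rewrite -(ler_nat R) natr_prod natrM natrX.
  apply: (@le_trans _ _ (m ^+ (\sum_(j < t) n j))).
    rewrite -prodrXr; apply: ler_prod => j _.
    by rewrite ler0n truncn_le (le_trans ler01).
  apply: le_trans (truncn_double (mX _)) _; rewrite ler_wpM2r//.
  by rewrite -[leLHS]expr1 ler_weXn2l// ler1n.
rewrite -(ler_nat R) natrM natrX natr_prod.
apply: (@le_trans _ _ (m ^+ (\sum_(j < t) n j))).
  by rewrite truncn_le (le_trans ler01).
rewrite -prodrXr.
have -> : 2 ^+ t = \prod_(j < t) (2 : R) by rewrite prodr_const card_ord.
rewrite -big_split /=; apply: ler_prod => j _.
by rewrite (le_trans ler01)//= truncn_double.
Qed.

(** Completeness provides a geometric representative, so the [xget] in [completion_class] does not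
    fall back on its default. *)
Lemma natbar_embedP (m : R) : 1 <= m ->
  seq_approx (2 : Sbar) (fun n => (Num.truncn (m ^+ n))%:R)
    (geom (natbar_embed 2 i m)).
Proof.
move=> m1; rewrite /natbar_embed gt_eqF ?(lt_le_trans ltr01)//.
have i2 : i 2 = 2 by exact: (rmorph_nat i 2).
have iE : i \o (fun n => (Num.truncn (m ^+ n))%:R) =
    (fun n => (Num.truncn (m ^+ n))%:R).
  by apply/funext => n /=; rewrite rmorph_nat.
have := completion_complete hi; rewrite i2 => comp.
have [n|x hx] := comp _ _ (natbar_approx_geometric m1).
  by apply: completion_natr_neq0; rewrite truncn_gt0 exprn_ege1.
rewrite /completion_class i2 iE.
exact: (@xgetPex _ 0 [set x : Sbar | seq_approx 2 _ (geom x)]) (ex_intro _ x hx).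
Qed.

Lemma le_natbar_embed (s : S) (m : R) : 1 <= m ->
  seq_lesssim 2 (geom s) (fun n => (Num.truncn (m ^+ n))%:R) ->
  i s <=s natbar_embed 2 i m.
Proof.
move=> m1 /(seq_lesssim_map (completion_monotone hi)).
rewrite geom_map natseq_map => h.
apply: (completion_closed hi); apply: seq_lesssim_trans h _.
by rewrite (rmorph_nat i 2); apply: (natbar_embedP m1).1.
Qed.

Lemma natbar_embed_le (s : S) (m : R) : 1 <= m ->
  seq_lesssim 2 (fun n => (Num.truncn (m ^+ n))%:R) (geom s) ->
  natbar_embed 2 i m <=s i s.
Proof.
move=> m1 /(seq_lesssim_map (completion_monotone hi)).
rewrite geom_map natseq_map => h.
apply: (completion_closed hi); apply: seq_lesssim_trans _ h.
by rewrite (rmorph_nat i 2); apply: (natbar_embedP m1).2.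
Qed.

(** The map [g] fixes natural numbers, so the truncated powers of [m] are equivalent both to the
    powers of [m] and to those of the image of its class; closedness of the nonnegative reals
    identifies the two. *)
Lemma functional_natbar_embed (f : {rmorphism S -> nnreal R}) :
  {homo f : x y / x <=s y} ->
  exists g : {rmorphism Sbar -> nnreal R},
    [/\ {homo g : x y / x <=s y}, f =1 g \o i &
        forall m : R, 1 <= m -> nnreal_val (g (natbar_embed 2 i m)) = m].
Proof.
move=> fhomo.
have [g [ghomo fg _]] := completion_universal hi (nnreal_power_universal R)
  (@nnreal_asymp_closed R) (@nnreal_asymp_complete R) fhomo.
exists g; split=> // m m1.
have m0 : m \is Num.nneg by rewrite nnegrE (le_trans ler01).
have [/(seq_lesssim_map ghomo) h1 /(seq_lesssim_map ghomo) h2] := natbar_embedP m1.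
rewrite geom_map natseq_map (rmorph_nat g 2) in h1 h2.
have mX n : 1 <= m ^+ n by apply: exprn_ege1.
have h3 : seq_lesssim 2 (geom (NNReal m0)) (fun n => (Num.truncn (m ^+ n))%:R).
  exists (fun=> 1%N) => [|n]; first exact: sublinear_cst.
  by rewrite /geom !nnrealE expr1; apply: truncn_double.
have h4 : seq_lesssim 2 (fun n => (Num.truncn (m ^+ n))%:R) (geom (NNReal m0)).
  exists (fun=> 0%N) => [|n]; first exact: sublinear_cst.
  by rewrite /geom !nnrealE expr0 mul1r truncn_le (le_trans ler01).
apply/le_anti/andP; split.
  exact: (nnreal_asymp_closed (seq_lesssim_trans h2 h4)).
exact: (nnreal_asymp_closed (seq_lesssim_trans h3 h1)).
Qed.

End Completion.

(** * Asymptotic rank and subrank as optimal real bounds *)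

Section AsymptoticRank.
Variables (R : realType) (S : preorderedSemiRingType).
Hypothesis hS : strassen_preorder S.

Lemma asymp_rank0 : asymp_rank R (0 : S) = 0.
Proof.
have r0 : rank (0 : S) = 0%N.
  by apply/eqP; rewrite -leqn0; apply: (rank_min hS 0).2; apply: psr_lexx.
apply/cvg_lim; first exact: Rhausdorff.
have : (fun=> 0 : R) @ \oo --> (0 : R) by apply: cvg_cst.
(* Index 0 is skipped because [0 ^+ 0 = 1] there. *)
apply: cvg_trans; apply: near_eq_cvg; exists 1%N => // n /= n0.
by rewrite expr0n eqn0Ngt n0 /= r0 powR0// invr_neq0// pnatr_eq0 -lt0n.
Qed.

Lemma asymp_rank_growth (s : S) (l : R) :
  exp_growth (fun n => rank (s ^+ n)) l -> asymp_rank R s = expR l.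
Proof. by move=> /exp_growth_cvg h; apply: (cvg_lim (@Rhausdorff R) h). Qed.

Lemma asymp_subrank_growth (s : S) (l : R) :
  exp_growth (fun n => subrank (s ^+ n)) l -> asymp_subrank R s = expR l.
Proof. by move=> /exp_growth_cvg h; apply: (cvg_lim (@Rhausdorff R) h). Qed.

Lemma rank_geom_lesssim (s : S) (l : R) :
  exp_growth (fun n => rank (s ^+ n)) l ->
  seq_lesssim 2 (geom s) (fun n => (Num.truncn (expR l ^+ n))%:R).
Proof.
move=> h; have l0 := exp_growth_ge0 h.
apply: (@sublinear_choice (fun n k =>
  geom s n <=s 2 ^+ k * (Num.truncn (expR l ^+ n))%:R)).
  (* A crude exponent for the finitely many small indices, from [r <= 2^r]. *)
  move=> n; exists (rank (s ^+ n)); apply: psr_le_trans (rank_min hS _).1 _.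
  rewrite -natrX -natrM; apply/(strassen_le_nat hS).
  apply: leq_trans (ltnW (ltn_expl _ (ltnSn 1))) _.
  by rewrite leq_pmulr// truncn_gt0 exprn_ege1// -expR0 ler_expR.
move=> d d0; have [N hN] := exp_growth_truncn h l0 d0.
exists N => n /hN[h1 _]; exists (n %/ d)%N; first by rewrite mulnC leq_trunc_div.
apply: psr_le_trans (rank_min hS _).1 _.
by rewrite -natrX -natrM; apply/(strassen_le_nat hS).
Qed.

Lemma subrank_geom_lesssim (s : S) (l : R) : s != 0 ->
  exp_growth (fun n => subrank (s ^+ n)) l ->
  seq_lesssim 2 (fun n => (Num.truncn (expR l ^+ n))%:R) (geom s).
Proof.
move=> s0 h; have l0 := exp_growth_ge0 h.
apply: (@sublinear_choice (fun n k =>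
  (Num.truncn (expR l ^+ n))%:R <=s 2 ^+ k * geom s n)).
  move=> n; have [K hK] := strassen_inv_bound hS (strassen_expf_neq0 hS n s0).
  set T := Num.truncn _; exists (T * K)%N.
  apply: (@psr_le_trans _ ((T * K)%N%:R * geom s n)).
    rewrite natrM -mulrA -[X in X <=s _]mulr1; exact: psr_leM2l.
  apply: psr_leM2r; rewrite -natrX; apply/(strassen_le_nat hS).
  exact/ltnW/ltn_expl.
move=> d d0; have [N hN] := exp_growth_truncn h l0 d0.
exists N => n /hN[_ h1]; exists (n %/ d)%N; first by rewrite mulnC leq_trunc_div.
apply: (@psr_le_trans _ (2 ^+ (n %/ d) * (subrank (s ^+ n))%:R)).
  by rewrite -natrX -natrM; apply/(strassen_le_nat hS).
by apply: psr_leM2l; apply: (subrank_max hS _).1.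
Qed.

Variables (Sbar : porderedSemiRingType) (i : {rmorphism S -> Sbar}).
Hypothesis hi : is_asymp_completion 2 i.

Lemma rank_growth_le (s : S) (l m : R) :
  exp_growth (fun n => rank (s ^+ n)) l -> 1 <= m ->
  i s <=s natbar_embed 2 i m -> expR l <= m.
Proof.
move=> h m1 sm; rewrite leNgt; apply/negP => ml.
(* The gap 4 covers two factors 2: rounding [m ^+ N] up to [p], and the loss in
   [exists_separating_functional]. *)
have [N N0 hN] := exists_pow_gap (lt_le_trans ltr01 m1) ml (ltr0n R 4).
have mN : 1 <= m ^+ N by apply: exprn_ege1.
pose p := (Num.truncn (m ^+ N)).+1.
have mp : m ^+ N < p%:R by apply: truncnS_gt.
have pm : p%:R <= 2 * m ^+ N.
  have : (Num.truncn (m ^+ N))%:R <= m ^+ N by rewrite truncn_le (le_trans ler01).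
  rewrite /p -natr1; lra.
have [[t t0 ht]|[f fhomo fp]] :=
    exists_separating_functional R hS (s ^+ N) (strassen_natr_neq0 hS (ltn0Sn _) : (p%:R : S) != 0).
  have [K hK] := strassen_expX_bound hS t0 ht.
  have : expR l ^+ N <= (2 * p)%:R.
    apply: (exp_growth_le (K := K) h N0); first by rewrite muln_gt0.
    move=> M; apply: (rank_min hS _).2; rewrite exprM natrM natrX natrM.
    exact: hK.
  rewrite natrM; lra.
have [g [ghomo fg gm]] := functional_natbar_embed hS hi fhomo.
have := ghomo _ _ sm; rewrite nnreal_leE gm// -[g (i s)]/((g \o i) s) -fg => fsm.
have fs0 := nnreal_val_ge0 (f s).
move: fp; rewrite rmorphXn rmorph_nat !nnrealE => pf.
have := lerXn2r N fs0 (le_trans ler01 m1) fsm; lra.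
Qed.

Lemma subrank_growth_ge (s : S) (p : nat) (l m : R) : 2 <=s s ^+ p ->
  exp_growth (fun n => subrank (s ^+ n)) l -> 1 <= m ->
  natbar_embed 2 i m <=s i s -> m <= expR l.
Proof.
move=> sp h m1 ms; rewrite leNgt; apply/negP => lm.
have [s0 _] := strassen_expX_eventually_ge1 hS sp.
have [N N0 hN] := exists_pow_gap (expR_gt0 l) lm (ltr0n R 4).
have lN : 1 <= expR l ^+ N.
  by apply: exprn_ege1; rewrite -expR0 ler_expR; apply: (exp_growth_ge0 h).
pose q := (Num.truncn (expR l ^+ N)).+1.
have lq : expR l ^+ N < q%:R by apply: truncnS_gt.
have ql : q%:R <= 2 * expR l ^+ N.
  have : (Num.truncn (expR l ^+ N))%:R <= expR l ^+ N.
    by rewrite truncn_le (le_trans ler01).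
  rewrite /q -natr1; lra.
(* With [2 * q] in place of [q], the factor 2 stands on both sides of the first alternative and is
   merged into the multiplier [t * 2]. *)
have [[t t0 ht]|[f fhomo fq]] :=
    exists_separating_functional R hS (2 * q%:R) (strassen_expf_neq0 hS N s0).
  have t20 : t * 2 != 0.
    by apply: (strassen_mulf_neq0 hS t0); apply: (strassen_natr_neq0 hS).
  rewrite !mulrA in ht; have [K hK] := strassen_expX_bound hS t20 ht.
  (* The constant factor [K] is absorbed by [s ^+ (p * K)], which exceeds it. *)
  have : q%:R <= expR l ^+ N.
    apply: (exp_growth_ge (K := (p * K)%N) h N0) => // M.
    apply: (subrank_max hS _).2; rewrite natrX exprD exprM mulrC.
    apply: psr_le_trans (hK M) _; apply: psr_leM2r; rewrite exprM.
    apply: psr_le_trans _ (psr_leX K sp); rewrite -natrX.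
    exact/(strassen_le_nat hS)/ltnW/ltn_expl.
  lra.
have [g [ghomo fg gm]] := functional_natbar_embed hS hi fhomo.
have := ghomo _ _ ms; rewrite nnreal_leE gm// -[g (i s)]/((g \o i) s) -fg => fsm.
have fs0 := nnreal_val_ge0 (f s).
move: fq; rewrite rmorphXn rmorphM !rmorph_nat !nnrealE => qf.
have := lerXn2r N (le_trans ler01 m1) fs0 fsm; lra.
Qed.

(** Rules out the candidate [m = 0] for nonzero [s]: the image of [1 <= K s] would give [1 <= 0] in
    the completion. *)
Lemma completion_le0 (s : S) : i s <=s 0 -> s = 0.
Proof.
move=> is0; apply/eqP/negPn/negP => /(strassen_inv_bound hS)[K hK].
have := completion_monotone hi hK; rewrite rmorphM rmorph1 => h.
have := psr_le_trans _ _ _ h (psr_leM2l (i K%:R) _ _ is0); rewrite mulr0 => h10.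
have := completion_natr_neq0 hS hi (ltn0Sn 0); rewrite (_ : 1%:R = 0) ?eqxx//.
by apply: psr_le_anti => //; apply: (completion_le_nat hS hi (leq0n 1)).
Qed.

End AsymptoticRank.

Theorem proposition5p7 (R : realType) (S : preorderedSemiRingType)
    (hS : strassen_preorder S) (Sbar : porderedSemiRingType)
    (i : {rmorphism S -> Sbar}) (hi : is_asymp_completion 2 i) (s : S) :
  minimum_of [set m : R | natbar m /\ i s <=s natbar_embed 2 i m]
    (asymp_rank R s) /\
  ((exists p : nat, 2 <=s s ^+ p) ->
   maximum_of [set m : R | natbar m /\ natbar_embed 2 i m <=s i s]
     (asymp_subrank R s)).
Proof.
have natbar_expR (l : R) : 0 <= l -> 1 <= expR l by rewrite -expR0 ler_expR.
split.
  (* The case [s = 0] is separate because its asymptotic rank 0 is not of the form [expR l]. *)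
  have [->|s0] := eqVneq s 0.
    rewrite asymp_rank0//; split.
      split; first by left.
      by rewrite rmorph0 /natbar_embed eqxx; apply: psr_lexx.
    by move=> m [[->|/(le_trans ler01)]].
  have [l hl] := rank_exp_growth R hS s0.
  have l1 := natbar_expR _ (exp_growth_ge0 hl).
  rewrite (asymp_rank_growth hl); split.
    split; first by right.
    exact: (le_natbar_embed hS hi l1 (rank_geom_lesssim hS hl)).
  move=> m [[->|m1] sm]; last exact: (rank_growth_le hS hi hl m1 sm).
  rewrite /natbar_embed eqxx in sm.
  by move: s0; rewrite (completion_le0 hS hi sm) eqxx.
move=> [p sp]; have [s0 _] := strassen_expX_eventually_ge1 hS sp.
have [l hl] := subrank_exp_growth R hS sp.
have l1 := natbar_expR _ (exp_growth_ge0 hl).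
rewrite (asymp_subrank_growth hl); split.
  split; first by right.
  exact: (natbar_embed_le hS hi l1 (subrank_geom_lesssim hS s0 hl)).
move=> m [[->|m1] ms]; first exact: expR_ge0.
exact: (subrank_growth_ge hS hi sp hl m1 ms).
Qed.
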